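(* Let $G=\mathbb{Z}_n$ be a cyclic group of order $n\in\mathbb{N}$, $n\geq 1$. Let $M$ be a set of integers and $S\subseteq G$ such that $G=MS$ is a complete splitting, and let $m\in M$, $g\in S$ be such that $0=mg$. Then $\frac{n}{(g,n)}=(m,n)$ and $M$ is a complete set of representatives modulo $\frac{n}{(g,n)}=(m,n)$; and $\frac{n}{(m,n)}=(n,g)$ and $S$ is a complete set of representatives modulo $\frac{n}{(m,n)}=(n,g)$.
   Context: For a set of integers $M$ and a subset $S$ of a finite abelian group $G$ (written additively), $G=MS$ is a complete splitting if every element of $G$ (including $0$) has a unique representation $ms$ with $m\in M$, $s\in S$. $(a,b)$ denotes the greatest common divisor (with $(0,b)=b$ for $b>0$). Elements of $\mathbb{Z}_n$ are regarded as integers modulo $n$; $(g,n)$ and the residue class of an element of $\mathbb{Z}_n$ modulo a divisor of $n$ are well defined. A complete set of representatives modulo $N$ is a set containing exactly one element from each residue class modulo $N$. *)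

(* Defs.v *)
From mathcomp Require Import all_boot all_algebra.
From mathcomp Require Import classical_sets.

Set Implicit Arguments.
Unset Strict Implicit.
Unset Printing Implicit Defensive.

Import GRing.Theory.
Local Open Scope ring_scope.
Local Open Scope classical_set_scope.

(* M is an arbitrary, possibly infinite, set of integers; [g *~ m] is the
   integer multiple m g in the additive group G. *)
Definition complete_splitting (G : finZmodType) (M : set int) (S : set G)
    : Prop :=
  forall x : G, exists! ms : int * G,
    [/\ M ms.1, S ms.2 & x = ms.2 *~ ms.1].

Definition complete_reps (N : int) (A : set int) : Prop :=
  forall r : int, exists! a : int, A a /\ (a = r %[mod N])%Z.

(* The cyclic group of order n + 1 is ['I_n.+1] with addition modulo n + 1
   (unlike ['Z_n.+1], this is also correct for order 1).  [Zlift] picks the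
   representative in [0, n]; gcds with n + 1 and residue classes modulo divisors
   of n + 1 do not depend on this choice. *)
Definition Zlift (n : nat) (x : 'I_n.+1) : int := (x : nat)%:Z.

(* Main.v *)
(** The multiples [m' g] with [m'] in [M], and the multiples [m s] with [s] in
    [S], are pairwise distinct; hence [M] is injective modulo
    [d = n / (g, n)] and [S] is injective modulo [e = n / (m, n)].  So [x = m' s]
    maps to [(m' mod d, s mod e)] injectively, which gives [n <= d e].
    As [m g = 0], [d] divides [(m, n) = n / e], so [d e <= n].  Therefore
    [d = (m, n)] and the map is a bijection onto pairs of residues. *)
Require Import Defs.
From mathcomp Require Import all_boot all_order all_algebra.
From mathcomp Require Import classical_sets.

Import Order.TTheory GRing.Theory Num.Theory.
Local Open Scope ring_scope.
Local Open Scope classical_set_scope.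

(** Valued in a finite type so that pairs of residues can be counted. The modulus is [d.+1], so the
    remainder is nonnegative and in range: neither the absolute value nor [inord] loses
    information. *)
Definition residue (d : nat) (a : int) : 'I_d.+1 := inord `|(a %% d.+1%:Z)%Z|.

Lemma residueP (d : nat) (a b : int) :
  residue d a = residue d b <-> (a = b %[mod d.+1%:Z])%Z.
Proof.
split=> [/(congr1 val)|]; last by rewrite /residue => ->.
have lt_mod c : (`|(c %% d.+1%:Z)%Z| < d.+1)%N.
  by rewrite -ltz_nat gez0_abs ?modz_ge0 // ltz_pmod.
rewrite /= !inordK // => /(congr1 Posz).
by rewrite !gez0_abs ?modz_ge0.
Qed.

Lemma complete_reps_residue (d : nat) (A : set int) :
  (forall a b, A a -> A b -> (a = b %[mod d.+1%:Z])%Z -> a = b) ->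
  (forall r, exists2 a, A a & residue d a = residue d r) ->
  complete_reps d.+1%:Z A.
Proof.
move=> injA surjA r; have [a Aa /residueP ar] := surjA r.
by exists a; split=> // b [Ab br]; apply: injA; rewrite // ar br.
Qed.

(** After division by [gcdz u N], the cofactors of [N] and [u] are coprime, and Gauss's lemma drops
    the cofactor of [u]. *)
Lemma dvdz_mul_divgcd (N u v : int) : N != 0 ->
  (N %| u * v)%Z = ((N %/ gcdz u N)%Z %| v)%Z.
Proof.
move=> N0; have k0 : gcdz u N != 0 by rewrite gcdz_eq0 negb_and N0 orbT.
have defN := divzK (dvdz_gcdr u N); have defu := divzK (dvdz_gcdl u N).
have cop : coprimez (N %/ gcdz u N)%Z (u %/ gcdz u N)%Z.
  rewrite coprimez_sym; apply/eqP; apply: (mulIf k0); rewrite mul1r.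
  by have := mulz_gcdl (u %/ gcdz u N)%Z (N %/ gcdz u N)%Z (gcdz u N);
    rewrite defN defu.
rewrite -(Gauss_dvdzr v cop) -{1}defN -{1}defu -mulrA (mulrC (gcdz u N)) mulrA.
by rewrite dvdz_mul2r.
Qed.

Lemma Zlift_inj (n : nat) (x y : 'I_n.+1) :
  (Zlift x = Zlift y %[mod n.+1%:Z])%Z -> x = y.
Proof. by rewrite /Zlift !modz_nat !modn_small // => -[] /val_inj. Qed.

Lemma ZliftD (n : nat) (x y : 'I_n.+1) :
  (Zlift (x + y) = Zlift x + Zlift y %[mod n.+1%:Z])%Z.
Proof. by rewrite /Zlift -PoszD !modz_nat /= modn_mod. Qed.

Lemma Zlift_mulz (n : nat) (x : 'I_n.+1) (a : int) :
  (Zlift (x *~ a) = Zlift x * a %[mod n.+1%:Z])%Z.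
Proof.
have nat_case (y : 'I_n.+1) k :
    (Zlift (y *+ k) = Zlift y * k%:Z %[mod n.+1%:Z])%Z.
  by rewrite /Zlift -PoszM !modz_nat Zp_mulrn /= modn_mod.
case: a => k; first exact: nat_case.
(* For a negative multiplier the claim is that the lifts of a natural multiple and of its opposite
   sum to 0 modulo [n.+1]. *)
apply/eqP; rewrite NegzE mulrNz mulrN eqz_mod_dvd opprK -[_ + _]subr0.
rewrite -eqz_mod_dvd -modzDmr -nat_case modzDmr -ZliftD.
by rewrite -pmulrn addNr.
Qed.

Lemma mulrz_eq_mod (n : nat) (x y : 'I_n.+1) (a b : int) :
  x *~ a = y *~ b <-> (Zlift x * a = Zlift y * b %[mod n.+1%:Z])%Z.
Proof.
rewrite -!Zlift_mulz; split=> [-> //|]; exact: Zlift_inj.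
Qed.

Theorem corollary7 (n : nat) (M : set int) (S : set 'I_n.+1)
  (hMS : complete_splitting M S)
  (m : int) (g : 'I_n.+1) (hm : M m) (hg : S g) (h0 : 0 = g *~ m) :
  ((n.+1%:Z %/ gcdz (Zlift g) n.+1%:Z)%Z = gcdz m n.+1%:Z /\
   complete_reps (n.+1%:Z %/ gcdz (Zlift g) n.+1%:Z)%Z M) /\
  ((n.+1%:Z %/ gcdz m n.+1%:Z)%Z = gcdz n.+1%:Z (Zlift g) /\
   complete_reps (n.+1%:Z %/ gcdz m n.+1%:Z)%Z [set Zlift s | s in S]).
Proof.
set N := n.+1%:Z; set d := (N %/ gcdz (Zlift g) N)%Z.
set e := (N %/ gcdz m N)%Z; have N0 : N != 0 by [].
have uniqMS a b s t : M a -> M b -> S s -> S t -> s *~ a = t *~ b ->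
    a = b /\ s = t.
  move=> Ma Mb Ss St eq_st; have [u [_ uniq_u]] := hMS (s *~ a).
  have eq1 : u = (a, s) by apply: uniq_u.
  have eq2 : u = (b, t) by apply: uniq_u.
  by move: eq1; rewrite eq2 => -[-> ->].
have injM a b : M a -> M b -> (a = b %[mod d])%Z -> a = b.
  move=> Ma Mb /eqP ab; case: (uniqMS a b g g) => //.
  apply/mulrz_eq_mod/eqP; rewrite eqz_mod_dvd -mulrBr dvdz_mul_divgcd //.
  by rewrite -eqz_mod_dvd.
have injS s t : S s -> S t -> (Zlift s = Zlift t %[mod e])%Z -> s = t.
  move=> Ss St /eqP st; case: (uniqMS m m s t) => //.
  apply/mulrz_eq_mod/eqP; rewrite eqz_mod_dvd -mulrBl mulrC dvdz_mul_divgcd //.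
  by rewrite -eqz_mod_dvd.
have defNd : d * gcdz (Zlift g) N = N by rewrite divzK ?dvdz_gcdr.
have defNe : e * gcdz m N = N by rewrite divzK ?dvdz_gcdr.
have gcd_gt0 u : 0 < gcdz u N.
  by rewrite lt_def gcdz_eq0 negb_and N0 orbT.
have d_gt0 : 0 < d by rewrite -(pmulr_lgt0 _ (gcd_gt0 (Zlift g))) defNd.
have e_gt0 : 0 < e by rewrite -(pmulr_lgt0 _ (gcd_gt0 m)) defNe.
have le_d : d <= gcdz m N.
  suff : (d %| gcdz m N)%Z.
    rewrite dvdzE => /dvdn_leq le_abs.
    rewrite -(gtz0_abs d_gt0) -(gtz0_abs (gcd_gt0 m)) lez_nat; apply: le_abs.
    exact: gcd_gt0.
  rewrite dvdz_gcd; apply/andP; split; last first.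
    by apply/dvdzP; exists (gcdz (Zlift g) N); rewrite mulrC defNd.
  rewrite -dvdz_mul_divgcd // -(subr0 (_ * m)) -eqz_mod_dvd -Zlift_mulz -h0.
  by rewrite /Zlift.
(* [residue] expects the predecessor of the modulus. *)
have [dn defd] : exists k : nat, d = k.+1%:Z.
  by case: (d) d_gt0 => [[|k]|] // _; exists k.
have [en defe] : exists k : nat, e = k.+1%:Z.
  by case: (e) e_gt0 => [[|k]|] // _; exists k.
(* The group is finite, so one representation of each element can be chosen simultaneously. *)
have /fin_all_exists [w wP] x : exists w : int * 'I_n.+1,
    [/\ M w.1, S w.2 & x = w.2 *~ w.1].
  by have [w [? _]] := hMS x; exists w.
pose f x := (residue dn (w x).1, residue en (Zlift (w x).2)).
have inj_f : injective f.
  move=> x y [] /residueP + /residueP.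
  have [Mx Sx defx] := wP x; have [My Sy defy] := wP y.
  rewrite -defd -defe => /(injM _ _ Mx My) eq1 /(injS _ _ Sx Sy) eq2.
  by rewrite defx defy eq1 eq2.
have le_N : N <= d * e.
  have := leq_card f inj_f.
  by rewrite card_prod !card_ord -lez_nat PoszM defd defe.
(* Multiplied by [e], the missing inequality [gcdz m N <= d] becomes [N <= e * d]. *)
have eq_d : d = gcdz m N.
  apply/le_anti; rewrite le_d -(ler_pM2l e_gt0) defNe /=.
  by rewrite mulrC.
have eq_e : e = gcdz N (Zlift g).
  apply: (mulIf (lt0r_neq0 d_gt0)).
  by rewrite {1}eq_d defNe gcdzC mulrC defNd.
(* Now [d * e = N], so [f] is an injection between finite types of equal size. *)
have [f' _ f'K] : bijective f.
  apply: inj_card_bij => //; rewrite card_prod !card_ord -lez_nat PoszM.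
  by rewrite -defd -defe eq_d mulrC defNe.
split; split=> //.
- rewrite defd; apply: complete_reps_residue; first by rewrite -defd.
  (* Only the first residue matters here; [ord0] is an arbitrary second one. *)
  move=> r; pose p : 'I_dn.+1 * 'I_en.+1 := (residue dn r, ord0).
  have [Mx _ _] := wP (f' p).
  by exists (w (f' p)).1 => //; have [] := f'K p.
rewrite defe; apply: complete_reps_residue; rewrite -?defe.
  by move=> _ _ [s Ss <-] [t St <-] /injS ->.
move=> r; pose p : 'I_dn.+1 * 'I_en.+1 := (ord0, residue en r).
have [_ Sx _] := wP (f' p).
exists (Zlift (w (f' p)).2); first by exists (w (f' p)).2.
by have [] := f'K p.
Qed.
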